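(* Let $(X,d)$ and $(Y,\rho)$ be finite nonempty ultrametric spaces, let $\eta\colon[0,\infty)\to[0,\infty)$ be a homeomorphism with $\eta(1)=1$, and let $f\colon X\to Y$ be a surjective $\eta$-quasisymmetric embedding. Then $f$ is a ball-preserving mapping.
   Context: An ultrametric space is a metric space $(X,d)$ satisfying $d(x,y)\leqslant\max\{d(x,z),d(z,y)\}$ for all $x,y,z\in X$. An embedding between metric spaces is an injective continuous mapping that is a homeomorphism onto its image. Given a homeomorphism $\eta\colon[0,\infty)\to[0,\infty)$, an embedding $f\colon X\to Y$ between metric spaces $(X,d)$ and $(Y,\rho)$ is $\eta$-quasisymmetric if for all $a,b,x\in X$ and all $t>0$, $d(x,a)\leqslant t\,d(x,b)$ implies $\rho(f(x),f(a))\leqslant\eta(t)\,\rho(f(x),f(b))$. A (closed) ball in a metric space $(X,d)$ is a set of the form $B_r(c)=\{x\in X\colon d(x,c)\leqslant r\}$ with $c\in X$ and $r\geqslant 0$ (so one-point sets are balls); $\mathbf{B}_X$ denotes the set of all balls in $X$. For nonempty metric spaces $X,Y$, a mapping $F\colon X\to Y$ is ball-preserving if $F(Z)\in\mathbf{B}_Y$ for every $Z\in\mathbf{B}_X$ and $F^{-1}(W)\in\mathbf{B}_X$ for every $W\in\mathbf{B}_Y$, where $F(Z)$ is the image and $F^{-1}(W)$ the preimage. *)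

(* Defs.v *)
From HB Require Import structures.
From mathcomp Require Import all_boot all_order all_algebra.
From mathcomp Require Import all_classical all_reals all_analysis.
Set Implicit Arguments.
Unset Strict Implicit.
Unset Printing Implicit Defensive.

Import Order.TTheory GRing.Theory Num.Theory.
Import numFieldNormedType.Exports.

Local Open Scope classical_set_scope.
Local Open Scope ring_scope.

(* f restricts to a homeomorphism between the subspaces A and B. The inverse g
   is a total function of which only the restriction to B matters; therefore T
   has to be inhabited as soon as U is. *)
Definition homeomorphism_on (T U : topologicalType) (A : set T) (B : set U)
    (f : T -> U) : Prop :=
  [/\ set_bij A B f, {within A, continuous f} &
      exists2 g : U -> T,
        {within B, continuous g} & forall x, A x -> g (f x) = x].

Definition embedding (T U : topologicalType) (f : T -> U) : Prop :=
  [/\ injective f, continuous f & homeomorphism_on [set: T] (range f) f].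

Definition ultrametric (R : realType) (X : metricType R) : Prop :=
  forall x y z : X, mdist x y <= Num.max (mdist x z) (mdist z y).

(* Homeomorphisms of [0, oo) are functions R -> R whose values at negative
   arguments are irrelevant. *)
Definition homeomorphism_nonneg (R : realType) (eta : R -> R) : Prop :=
  @homeomorphism_on R R `[0, +oo[ `[0, +oo[ eta.

Definition quasisymmetric (R : realType) (X Y : metricType R) (eta : R -> R)
    (f : X -> Y) : Prop :=
  embedding f /\
  forall (a b x : X) (t : R), 0 < t ->
    mdist x a <= t * mdist x b ->
    mdist (f x) (f a) <= eta t * mdist (f x) (f b).

(* The library's [ball] is open and its [closed_ball] is the closure of an open
   ball, which is not the closed ball of a general metric space. *)
Definition cball (R : realType) (X : metricType R) (c : X) (r : R) : set X :=
  [set x | mdist x c <= r].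

Definition balls (R : realType) (X : metricType R) : set (set X) :=
  [set Z | exists c : X, exists2 r : R, 0 <= r & Z = cball c r].
Arguments balls {R} X.

Definition ball_preserving (R : realType) (X Y : metricType R) (F : X -> Y) :
    Prop :=
  (forall Z : set X, balls X Z -> balls Y (F @` Z)) /\
  (forall W : set Y, balls Y W -> balls X (F @^-1` W)).

(* Main.v *)
(* Applying quasisymmetry with t = 1, and with t < 1 where eta t < 1, shows that
   f preserves and reflects the comparison of two distances from a common point.
   In a finite space the radius of a ball can be taken to be the distance from
   the centre to a farthest point of the ball, so balls are described by such
   comparisons alone. *)
Require Import Defs.
From mathcomp Require Import all_boot all_order all_algebra.
From mathcomp Require Import all_classical all_reals all_analysis.
Import Order.TTheory GRing.Theory Num.Theory.
Local Open Scope classical_set_scope.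
Local Open Scope ring_scope.

(** A continuous injection on an interval is strictly monotone. Were [eta] decreasing, [eta 0] would
    be its largest value, yet by surjectivity [eta 0 + 1] is attained. *)
Lemma homeomorphism_nonneg_lt {R : realType} {eta : R -> R} :
  homeomorphism_nonneg eta ->
  forall s t, 0 <= s -> s < t -> eta s < eta t.
Proof.
move=> [[eta_fun eta_inj eta_surj] eta_cont _] s t s0 st.
have mem (x : R) : 0 <= x -> x \in `[0, +oo[ by rewrite in_itv /= andbT.
have t0 : 0 <= t by rewrite (le_trans s0)// ltW.
have inj : {in `[0, +oo[ &, injective eta}.
  by move=> x y xI yI; apply: eta_inj; rewrite inE.
case: (itv_continuous_inj_mono eta_cont inj) => mono.
  by apply: mono; rewrite ?mem.
have eta0 : 0 <= eta 0 + 1.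
  by have := eta_fun 0; rewrite /= !in_itv /= !andbT lexx => /(_ isT) /addr_ge0 ->.
have /eta_surj[u /= uI eta_u] : [set` `[0, +oo[] (eta 0 + 1) by exact: mem.
have : eta u <= eta 0.
  have : 0 <= u by move: uI; rewrite in_itv /= andbT.
  rewrite le_eqVlt => /predU1P[<-//|u0]; apply: ltW; apply: mono => //.
  by rewrite mem.
by rewrite eta_u gerDl ler10.
Qed.

Lemma finite_set_argmax {R : realType} {T : choiceType} (g : T -> R) (A : set T) :
  finite_set A -> A !=set0 ->
  exists2 b, A b & forall x, A x -> g x <= g b.
Proof.
move=> /finite_seqP[s ->] [x0 /= x0s]; elim: s x0 x0s => // a s IH x0 _.
case: s IH => [_|a' s IH].
  by exists a => [|x] /=; rewrite inE // => /eqP ->.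
have [b bs b_max] := IH a' (mem_head _ _).
have [gab|gba] := leP (g a) (g b).
  exists b => [|x] /=; first by rewrite in_cons bs orbT.
  by rewrite in_cons => /orP[/eqP ->//|/b_max].
exists a => [|x] /=; first exact: mem_head.
by rewrite in_cons => /orP[/eqP ->//|/b_max /le_trans]; apply; exact: ltW.
Qed.

(** Trades an arbitrary radius, which a map cannot transport, for a distance between two points,
    which it can. *)
Lemma cball_farthest {R : realType} {X : metricType R} (c : X) (r : R) :
  finite_set [set: X] -> 0 <= r ->
  exists b, cball c r = cball c (mdist b c).
Proof.
move=> finX r0; have [||b br b_max] := finite_set_argmax (mdist ^~ c) (cball c r).
- exact: sub_finite_set finX.
- by exists c; rewrite /cball /= mdistxx.
by exists b; apply/seteqP; split=> x /= => [/b_max//|/le_trans]; apply.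
Qed.

Lemma quasisymmetric_mdist_le {R : realType} {X Y : metricType R}
    {eta : R -> R} {f : X -> Y} :
  homeomorphism_nonneg eta -> eta 1 = 1 -> quasisymmetric eta f ->
  forall a b x : X,
    (mdist (f a) (f x) <= mdist (f b) (f x)) = (mdist a x <= mdist b x).
Proof.
move=> eta_homeo eta1 [[f_inj _ _] f_qs] a b x.
rewrite !(metric_sym _ x) !(metric_sym _ (f x)).
apply/idP/idP => [fab|ab]; last first.
  by have := f_qs a b x 1 ltr01; rewrite eta1 !mul1r; apply.
rewrite leNgt; apply/negP => ba.
have a_gt0 : 0 < mdist x a by rewrite (le_lt_trans _ ba)// mdist_ge0.
have fa_gt0 : 0 < mdist (f x) (f a).
  rewrite mdist_gt0; apply: contraTneq a_gt0 => /f_inj ->.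
  by rewrite mdistxx ltxx.
(* The case [x = b] is set apart because the ratio used below must be positive. *)
have [xb|xb] := eqVneq x b.
  by move: fab; rewrite -xb mdistxx leNgt fa_gt0.
have b_gt0 : 0 < mdist x b by rewrite mdist_gt0.
(* With [a] and [b] exchanged, this ratio [t] turns the premise of quasisymmetry into an equality.
   Since [t < 1], [eta t < eta 1 = 1], so [f b] would be strictly closer to [f x] than [f a],
   against [fab]. *)
have := f_qs b a x (mdist x b / mdist x a) (divr_gt0 b_gt0 a_gt0).
rewrite divfK ?gt_eqF// => /(_ (lexx _)); apply/negP; rewrite -ltNge.
apply: lt_le_trans fab; rewrite gtr_pMl// -[ltRHS]eta1.
apply: homeomorphism_nonneg_lt => //; first by rewrite divr_ge0 ?mdist_ge0.
by rewrite ltr_pdivrMr// mul1r.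
Qed.

Theorem proposition3p5 (R : realType) (X Y : metricType R)
    (finX : finite_set [set: X]) (X0 : [set: X] !=set0)
    (finY : finite_set [set: Y]) (Y0 : [set: Y] !=set0)
    (ultraX : ultrametric X) (ultraY : ultrametric Y)
    (eta : R -> R) (eta_homeo : homeomorphism_nonneg eta) (eta1 : eta 1 = 1)
    (f : X -> Y) (f_surj : set_surj [set: X] [set: Y] f)
    (f_qs : quasisymmetric eta f) :
  ball_preserving f.
Proof.
have f_le := quasisymmetric_mdist_le eta_homeo eta1 f_qs.
have f_onto y : exists x, f x = y by have [x _] := f_surj y I; exists x.
split=> [_ [c [r r0 ->]]|_ [d [r r0 ->]]].
  have [b ->] := cball_farthest c r finX r0.
  (* The image of the farthest point fixes the new radius, so membership on both sides is a
     comparison covered by [f_le]. *)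
  exists (f c); exists (mdist (f b) (f c)); first exact: mdist_ge0.
  apply/seteqP; split=> [_ [x /= xb <-]|y]; first by rewrite /cball /= f_le.
  by have [x <-] := f_onto y; rewrite /cball /= f_le; exists x.
have [e ->] := cball_farthest d r finY r0.
(* Centre and farthest point are both pulled back to [X], where they determine the preimage ball. *)
have [[c <-] [b <-]] := (f_onto d, f_onto e).
exists c; exists (mdist b c); first exact: mdist_ge0.
by apply/seteqP; split=> x; rewrite /cball /= f_le.
Qed.
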